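(* Let $\mathbb{F}_q$ be a finite field with $q=2n+1>2^{66}$ elements. Let $S=\{a^2:\ a\in\mathbb{F}_q^*\}$ where $\mathbb{F}_q^*=\mathbb{F}_q\setminus\{0\}$, and let $T=\mathbb{F}_q^*\setminus S$. Then for each $R\in\{S,T\}$: (a) there is an ordering $a_1,\ldots,a_n$ of all the $n$ elements of $S$ such that $$\{a_1+a_2,\ a_2+a_3,\ \ldots,\ a_{n-1}+a_n,\ a_n+a_1\}=R;$$ (b) there is an ordering $b_1,\ldots,b_n$ of all the $n$ elements of $S$ such that $$\{b_1-b_2,\ b_2-b_3,\ \ldots,\ b_{n-1}-b_n,\ b_n-b_1\}=R.$$ *)

(* Defs.v *)
From HB Require Import structures.
From mathcomp Require Export all_boot all_order all_algebra.

Set Implicit Arguments.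
Unset Strict Implicit.
Unset Printing Implicit Defensive.

Import GRing.Theory.
Local Open Scope ring_scope.

Definition nonzero_squares (F : finFieldType) : {set F} :=
  [set a ^+ 2 | a in [set~ (0 : F)]].

Definition nonsquares (F : finFieldType) : {set F} :=
  [set~ (0 : F)] :\: nonzero_squares F.

Definition ordering_of (F : finFieldType) (n : nat) (A : {set F})
    (s : 'I_n -> F) : Prop :=
  injective s /\ [set s i | i : 'I_n] = A.

(* ordS is the cyclic successor on 'I_n: the last index is followed by 0. *)
Definition cyclic_sums (F : finFieldType) (n : nat) (s : 'I_n -> F) : {set F} :=
  [set s i + s (ordS i) | i : 'I_n].

Definition cyclic_diffs (F : finFieldType) (n : nat) (s : 'I_n -> F) : {set F} :=
  [set s i - s (ordS i) | i : 'I_n].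

(* Main.v *)
Require Import Defs.
From mathcomp Require Import all_boot all_order all_algebra.
From mathcomp Require Import cyclic finfield zify.

(**
If [h] generates the group [S] of nonzero squares, then for [s = 1] or [s = -1]
the ordering [h^0, h^1, ..., h^(n-1)] of [S] satisfies
[h^i + s h^(i+1) = h^i (1 + s h)], so that its cyclic sums (or differences) form
the coset [(1 + s h) S].  It remains to find a generator [h] for which [1 + s h]
is a square, or a nonsquare; equivalently, one for which the quadratic character
[chi] takes a prescribed sign at [s + h].

For the group [H] of [m]-th roots of unity the sum [E c] of [chi (c + x)] over
[x] in [H] satisfies [(E c)^2 <= q] for [c <> 0]: the sum of [(E c)^2] over all
[c] is [#|H| (q - #|H|)], and [(E c)^2] is constant on the cosets of [H].
Inclusion-exclusion over the prime divisors of [n] shows that the sum of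
[chi (s + h)] over the generators [h] is at most [2^omega(n)] times the ceiling
of [sqrt q], which is less than [totient n - 1] for large [q].  Hence
[chi (s + h)] takes both signs.
*)

Set Implicit Arguments.
Unset Strict Implicit.
Unset Printing Implicit Defensive.

Import Order.TTheory GRing.Theory Num.Theory.
Local Open Scope ring_scope.

(** * The quadratic character and the cyclic group of nonzero squares *)

Definition quad_char (F : finFieldType) (x : F) : int :=
  if x == 0 then 0 else if x \in nonzero_squares F then 1 else -1.

Lemma card_odd_half_gt0 (F : finFieldType) (n : nat) :
  #|F| = (2 * n + 1)%N -> (0 < n)%N.
Proof. by move=> hq; have := card_finNzRing_gt1 F; rewrite hq; case: n {hq}. Qed.

Lemma expf_unit_order (F : finFieldType) (n : nat) (x : F) :
  #|F| = (2 * n + 1)%N -> x != 0 -> x ^+ (2 * n) = 1.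
Proof.
move=> hq x0; have := expf_card x.
by rewrite hq addn1 exprS -[RHS]mulr1 => /(mulfI x0).
Qed.

Lemma prim_root_neq0 (F : fieldType) (n : nat) (z : F) :
  n.-primitive_root z -> z != 0.
Proof.
by move=> pz; rewrite (prim_root_eq0 pz) -lt0n (prim_order_gt0 pz).
Qed.

Lemma primitive_element (F : finFieldType) (n : nat) :
  #|F| = (2 * n + 1)%N -> exists w : F, (2 * n).-primitive_root w.
Proof.
move=> hq; have n0 := card_odd_half_gt0 hq.
have /hasP[w _ pw] : has (2 * n).-primitive_root (enum [set~ (0 : F)]).
  apply: has_prim_root; first by rewrite muln_gt0.
  - apply/allP => x; rewrite mem_enum !inE => x0.
    by apply/unity_rootP; exact: expf_unit_order.
  - exact: enum_uniq.
  - by rewrite -cardE cardsC1 hq addn1.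
by exists w.
Qed.

Lemma primitive_root_of_squares (F : finFieldType) (n : nat) :
  #|F| = (2 * n + 1)%N -> exists z : F, n.-primitive_root z.
Proof.
move=> hq; have [w pw] := primitive_element hq.
exists (w ^+ (2 * n %/ n)); apply: (dvdn_prim_root pw).
exact: dvdn_mull.
Qed.

(** Euler's criterion: the square of a generator of the multiplicative group is a primitive [n]-th
    root of unity, so its powers exhaust the solutions of [x ^+ n = 1]. *)
Lemma mem_nonzero_squares (F : finFieldType) (n : nat) (x : F) :
  #|F| = (2 * n + 1)%N -> (x \in nonzero_squares F) = (x ^+ n == 1).
Proof.
move=> hq; have n0 := card_odd_half_gt0 hq.
apply/imsetP/eqP => [[a]|xn1].
  by rewrite !inE => a0 ->; rewrite -exprM; exact: expf_unit_order.
have [w pw] := primitive_element hq.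
have := dvdn_prim_root pw (dvdn_mull 2 (dvdnn n)).
rewrite mulnK // => pw2.
have [i ->] := prim_rootP pw2 xn1.
exists (w ^+ i); last by rewrite -!exprM mulnC.
by rewrite !inE expf_neq0 // (prim_root_neq0 pw).
Qed.

Lemma expf_half (F : finFieldType) (n : nat) (x : F) :
  #|F| = (2 * n + 1)%N -> x != 0 -> x ^+ n = 1 \/ x ^+ n = -1.
Proof.
move=> hq /(expf_unit_order hq) /eqP.
by rewrite mulnC exprM sqrf_eq1 => /orP[]/eqP; [left | right].
Qed.

Lemma oppr1_neq1 (F : finFieldType) (n : nat) :
  #|F| = (2 * n + 1)%N -> (-1 == 1 :> F) = false.
Proof.
move=> hq; have n0 := card_odd_half_gt0 hq; apply/negP => /eqP h.
have [w pw] := primitive_element hq.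
have w0 := prim_root_neq0 pw.
have wn : w ^+ n == 1 by case: (expf_half hq w0) => ->; rewrite ?h.
have := prim_order_dvd pw n; rewrite wn => /(dvdn_leq n0); lia.
Qed.

Lemma quad_char0 (F : finFieldType) : quad_char (0 : F) = 0.
Proof. by rewrite /quad_char eqxx. Qed.

Lemma quad_char1 (F : finFieldType) : quad_char (1 : F) = 1.
Proof.
rewrite /quad_char oner_eq0 ifT //; apply/imsetP; exists 1.
  by rewrite !inE oner_eq0.
by rewrite expr1n.
Qed.

Lemma quad_charM (F : finFieldType) (n : nat) (x y : F) :
  #|F| = (2 * n + 1)%N -> quad_char (x * y) = quad_char x * quad_char y.
Proof.
move=> hq; rewrite /quad_char mulf_eq0 !(mem_nonzero_squares _ hq).
case: (eqVneq x 0) => [|x0] /=; first by rewrite mul0r.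
case: (eqVneq y 0) => [|y0] /=; first by rewrite mulr0.
have h := oppr1_neq1 hq.
by rewrite exprMn; case: (expf_half hq x0) => ->; case: (expf_half hq y0) => ->;
  rewrite ?mulrNN ?mulr1 ?mul1r ?eqxx ?h.
Qed.

Lemma quad_char_sqr (F : finFieldType) (x : F) :
  x != 0 -> quad_char x ^+ 2 = 1.
Proof. by move=> /negPf x0; rewrite /quad_char x0; case: ifP. Qed.

Lemma quad_char_eq1 (F : finFieldType) (x : F) :
  (quad_char x == 1) = (x \in nonzero_squares F).
Proof.
rewrite /quad_char; case: (eqVneq x 0) => [->|x0]; last by case: ifP.
rewrite [LHS]/=; apply/esym/negbTE/negP => /imsetP[a].
rewrite !inE => a0 /eqP.
by rewrite eq_sym expf_eq0 (negPf a0).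
Qed.

Lemma quad_char_eqN1 (F : finFieldType) (x : F) :
  (quad_char x == -1) = (x \in nonsquares F).
Proof.
rewrite /quad_char /nonsquares !inE.
by case: (x == 0); case: (x \in nonzero_squares F).
Qed.

(** * Sums of the quadratic character *)

(** Multiplication by a generator, which is a nonsquare, permutes the field and flips the sign of
    each term. *)
Lemma sum_quad_char (F : finFieldType) (n : nat) :
  #|F| = (2 * n + 1)%N -> \sum_(x : F) quad_char x = 0.
Proof.
move=> hq; have n0 := card_odd_half_gt0 hq.
have [w pw] := primitive_element hq.
have w0 := prim_root_neq0 pw.
have qw : quad_char w = -1.
  rewrite /quad_char (negPf w0) (mem_nonzero_squares _ hq) ifF //.
  apply/negP => wn.
  have := prim_order_dvd pw n; rewrite wn => /(dvdn_leq n0); lia.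
have : \sum_(x : F) quad_char x = \sum_(x : F) quad_char (w * x).
  by apply: reindex_inj; apply: mulfI.
under [X in _ = X]eq_bigr => x _ do rewrite (quad_charM _ _ hq) qw mulN1r.
by rewrite sumrN; move: (\sum_(x : F) quad_char x) => s; lia.
Qed.

(** Off the diagonal, with [d = y - x], translation turns the summand into
    [quad_char (c * (c + d))], which is [quad_char (1 + d / c)] for [c != 0]. As [d / c] runs over
    the nonzero elements, the complete sum 0 lacks only the term [quad_char 1]. *)
Lemma sum_quad_char_shifts (F : finFieldType) (n : nat) (x y : F) :
  #|F| = (2 * n + 1)%N ->
  \sum_(c : F) quad_char (c + x) * quad_char (c + y)
    = (if x == y then #|F|%:R else 0) - 1.
Proof.
move=> hq.
rewrite (reindex_inj (addIr (- x))) /=.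
under eq_bigr => c _ do rewrite subrK -addrA (addrC (- x)).
case: (eqVneq x y) => [->|xy].
  rewrite subrr (bigD1 0) //= quad_char0 mul0r add0r.
  rewrite (eq_bigr (fun=> 1)); last first.
    by move=> c c0; rewrite addr0 -expr2 quad_char_sqr.
  by rewrite sumr_const cardC1 -subn1 natrB // ltnW // card_finNzRing_gt1.
move: (y - x) (subr_eq0 y x) => d; rewrite [y == x]eq_sym (negPf xy) => d0.
rewrite (bigD1 0) //= quad_char0 mul0r add0r.
rewrite (eq_bigr (fun c => quad_char (1 + d / c))); last first.
  move=> c c0; have -> : c + d = c * (1 + d / c).
    by rewrite mulrDr mulr1 mulrCA divff // mulr1.
  by rewrite (quad_charM _ _ hq) mulrA -expr2 quad_char_sqr // mul1r.
(* Since [0^-1 = 0], this holds at [c = 0] too. *)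
have dK : involutive (fun c : F => d / c).
  move=> c; rewrite invf_div mulrCA divff ?mulr1 //.
  by rewrite d0.
rewrite (reindex_inj (can_inj dK)) /=.
have -> : \sum_(c | d / c != 0) quad_char (1 + d / (d / c))
  = \sum_(c : F | c != 0) quad_char (1 + c).
  apply: eq_big => [c|c _]; last by congr (quad_char (1 + _)); apply: dK.
  by rewrite mulf_eq0 d0 invr_eq0.
have : \sum_(c : F) quad_char (1 + c) = 0.
  by rewrite -[RHS](sum_quad_char hq) [RHS](reindex_inj (addrI 1)) /=.
rewrite (bigD1 0) //= addr0 quad_char1 => h.
by rewrite sub0r; apply/eqP; rewrite -addr_eq0 addrC h.
Qed.

(* The sums over the translates [c] and [c * h], [h ^+ m = 1], have the same
   square, so that each term of the second moment over all [c] is repeated. *)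
Lemma quad_char_sum_roots (F : finFieldType) (n m : nat) (c : F) :
  #|F| = (2 * n + 1)%N -> (0 < m)%N -> c != 0 ->
  (\sum_(x : F | x ^+ m == 1) quad_char (c + x)) ^+ 2 <= #|F|%:R :> int.
Proof.
move=> hq m0 c0.
pose E c := \sum_(x : F | x ^+ m == 1) quad_char (c + x).
pose H := [pred x : F | x ^+ m == 1].
have Hn0 x : H x -> x != 0.
  move=> /= xm; apply/eqP => x0; move: xm.
  by rewrite x0 expr0n eqn0Ngt m0 eq_sym oner_eq0.
(* Expand the square and sum over [c] first: each pair [(x, y)] contributes -1, and each diagonal
   pair [#|F|] more. *)
have moment : \sum_(c : F) E c ^+ 2 = #|H|%:R * #|F|%:R - #|H|%:R ^+ 2.
  under eq_bigr => d _ do rewrite expr2 mulr_suml.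
  under eq_bigr => d _ do under eq_bigr => x _ do rewrite mulr_sumr.
  rewrite exchange_big /=.
  under eq_bigr => x _ do rewrite exchange_big /=.
  under eq_bigr => x _ do under eq_bigr => y _ do
    rewrite (sum_quad_char_shifts _ _ hq).
  have inner (x : F) : x ^+ m == 1 ->
    \sum_(y : F | y ^+ m == 1) ((if x == y then #|F|%:R else 0) - 1)
      = (#|F|%:R : int) - #|H|%:R.
    move=> hx; rewrite big_split /= sumrN sumr_const; congr (_ - _).
    rewrite -big_mkcondr (big_pred1 x) // => y /=.
    by rewrite [x == y]eq_sym; case: (eqVneq y x) => [->|]; rewrite ?hx ?andbF.
  rewrite (eq_bigr _ inner) sumr_const -[LHS]mulr_natl mulrBr expr2.
  by [].
have inv h : H h -> E (c * h) ^+ 2 = E c ^+ 2.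
  move=> hh; have h0 := Hn0 _ hh.
  rewrite /E (reindex_inj (mulIf h0)) /=.
  rewrite (eq_big (fun x => x ^+ m == 1) (fun x => quad_char (c + x) * quad_char h)).
  - by rewrite -mulr_suml exprMn quad_char_sqr // mulr1.
  - by move=> x; rewrite exprMn (eqP (hh : h ^+ m == 1)) mulr1.
  - by move=> x _; rewrite -mulrDl (quad_charM _ _ hq).
have H0 : (0 < #|H|)%N by apply/card_gt0P; exists 1; rewrite inE /= expr1n.
have low : #|H|%:R * E c ^+ 2 <= \sum_(c : F) E c ^+ 2.
  rewrite (reindex_inj (mulfI c0)) (bigID H) /=.
  rewrite (eq_bigr _ inv) sumr_const -[X in _ <= X + _]mulr_natl lerDl.
  by apply: sumr_ge0 => x _; exact: sqr_ge0.
rewrite -/(E c) -(ler_pM2l (_ : 0 < #|H|%:R)) ?ltr0n //.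
apply: le_trans low _; rewrite moment lerBlDr lerDl; exact: sqr_ge0.
Qed.

(** * Sieving roots of unity down to the primitive ones *)

Lemma expr_gcdn_eq1 (F : fieldType) (m k : nat) (x : F) : (0 < m)%N ->
  (x ^+ gcdn m k == 1) = (x ^+ m == 1) && (x ^+ k == 1).
Proof.
move=> m0; apply/idP/andP => [|[/eqP xm xk]].
  move=> /eqP h; split.
    by rewrite -(divnK (dvdn_gcdl m k)) mulnC exprM h expr1n.
  by rewrite -(divnK (dvdn_gcdr m k)) mulnC exprM h expr1n.
have [r pr rm] := prim_order_exists m0 xm.
by rewrite -(prim_order_dvd pr) dvdn_gcd rm (prim_order_dvd pr).
Qed.

(** If the order [m] of [x] is a proper divisor of [n], then [x ^+ (n %/ p) = 1] for any prime [p]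
    dividing [n %/ m]. The sieve thus needs one condition per prime of [n]. *)
Lemma prim_root_maximal_divisors (F : fieldType) (n : nat) (x : F) :
  (0 < n)%N ->
  n.-primitive_root x =
    (x ^+ n == 1) && all (fun k => x ^+ k != 1) [seq (n %/ p)%N | p <- primes n].
Proof.
move=> n0; apply/idP/andP => [px|[/eqP xn /allP hx]].
  split; first by rewrite (prim_expr_order px).
  apply/allP => k /mapP[p]; rewrite mem_primes => /and3P[pp _ pn] ->.
  rewrite -(prim_order_dvd px); apply/negP => /dvdn_leq.
  rewrite divn_gt0 ?prime_gt0 // dvdn_leq // => /(_ isT).
  by rewrite leqNgt ltn_Pdiv ?prime_gt1.
have [m pm mn] := prim_order_exists n0 xn.
have [<- //|nm] := eqVneq m n.
have m0 := prim_order_gt0 pm.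
have nm1 : (1 < n %/ m)%N.
  rewrite ltn_divRL // mul1n ltn_neqAle nm; exact: dvdn_leq.
have pp := pdiv_prime nm1; have pd := pdiv_dvd (n %/ m).
have pn : (pdiv (n %/ m) %| n)%N by apply: dvdn_trans pd (dvdn_div mn).
have /hx : (n %/ pdiv (n %/ m))%N \in [seq (n %/ p)%N | p <- primes n].
  by apply: map_f; rewrite mem_primes pp n0.
case/negP; rewrite -(prim_order_dvd pm) dvdn_divRL // -{2}(divnK mn) mulnC.
by rewrite dvdn_pmul2r.
Qed.

(** Induction on [ks]: the sum with [x ^+ k != 1] is the sum without this condition minus the one
    with [x ^+ k = 1], where [m] becomes [gcdn m k]. Each [k] thus doubles the bound. *)
Lemma sieve_bound (F : finFieldType) (f : F -> int) (b : int) :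
  (forall m, (0 < m)%N -> `|\sum_(x : F | x ^+ m == 1) f x| <= b) ->
  forall (ks : seq nat) (m : nat), (0 < m)%N ->
  `|\sum_(x : F | (x ^+ m == 1) && all (fun k => x ^+ k != 1) ks) f x|
    <= b *+ 2 ^ size ks.
Proof.
move=> hb; elim=> [|k ks IH] m m0 /=.
  by under eq_bigl => x do rewrite andbT; exact: hb.
have g0 : (0 < gcdn m k)%N by rewrite gcdn_gt0 m0.
have := IH m m0; rewrite (bigID (fun x : F => x ^+ k == 1)) /=.
rewrite (eq_bigl (fun x : F => (x ^+ gcdn m k == 1) &&
    all (fun k => x ^+ k != 1) ks)); last first.
  by move=> x; rewrite expr_gcdn_eq1 // andbAC.
rewrite [X in `|_ + X| <= _](eq_bigl (fun x : F => [&& x ^+ m == 1, x ^+ k != 1 &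
    all (fun k => x ^+ k != 1) ks])); last first.
  by move=> x; rewrite -andbA [X in _ && X]andbC.
move: (IH _ g0); rewrite expnS mulnC muln2 -addnn mulrnDr.
by move: (\sum_(_ | _) _) (\sum_(_ | _) _) (b *+ _) => u v w; lia.
Qed.

(** * Counting generators: lower bounds for the totient *)

Lemma totient_le_card_prim_roots (F : finFieldType) (n : nat) (z : F) :
  n.-primitive_root z -> (totient n <= #|[pred x : F | n.-primitive_root x]|)%N.
Proof.
move=> pz.
have inj : injective (fun i : 'I_n => z ^+ i).
  move=> i j /eqP; rewrite (eq_prim_root_expr pz) !modn_small // => /eqP.
  exact: val_inj.
have -> : totient n = #|[set z ^+ i | i : 'I_n & coprime i n]|.
  rewrite card_imset // totient_count_coprime big_mkord -sum1dep_card [RHS]big_mkcond.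
  by apply: eq_bigr => i _; rewrite coprime_sym; case: coprime.
apply/subset_leq_card/subsetP => x /imsetP[i]; rewrite inE => hi ->.
by rewrite inE (prim_root_exp_coprime _ pz).
Qed.

Lemma prod_indicator_leq (a k : nat) (s : seq nat) : (0 < k)%N -> uniq s ->
  (\prod_(p <- s) (if p == a then k else 1) <= k)%N.
Proof.
move=> k0; rewrite -big_mkcond; elim: s => [|p s IH] /=; first by rewrite big_nil.
case/andP => ps us; rewrite big_cons; case: eqP => [pa|_]; last exact: IH.
rewrite big_seq_cond big1 ?muln1 // => i /andP[i_s /eqP ia].
by rewrite pa -ia i_s in ps.
Qed.

(* The correcting factors are the least integers [K] such that
   [8 * p ^ 2 <= K * p.-1 ^ 3]; for [p >= 11] one can take [K = 1]. *)
Lemma totient_prime_power_bound (p e : nat) : prime p -> (0 < e)%N ->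
  (8 * (p ^ e) ^ 2 <= (p.-1 * p ^ e.-1) ^ 3 *
    ((if p == 2 then 32 else 1) * (if p == 3 then 9 else 1) *
     (if p == 5 then 4 else 1) * (if p == 7 then 2 else 1)))%N.
Proof.
move=> pp; case: e => // e _ /=.
set K := (_ * _ * _ * _)%N.
(* Exponent one suffices: each further factor [p] multiplies the left side by [p ^ 2] and the right
   side by [p ^ 3]. *)
have base : (8 * p ^ 2 <= p.-1 ^ 3 * K)%N.
  rewrite /K {K}; have [p11|] := leqP 11 p.
    have -> : (p == 2) = false by lia.
    have -> : (p == 3) = false by lia.
    have -> : (p == 5) = false by lia.
    have -> : (p == 7) = false by lia.
    have [r ->] : exists r, p = (r + 11)%N by exists (p - 11)%N; lia.
    rewrite addnS /= !expnS expn0; nia.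
  by move: pp; do 11 case: p => [|p] //.
have P0 := prime_gt0 pp.
have pe0 : (0 < p ^ e)%N by rewrite expn_gt0 P0.
rewrite [(p ^ e.+1)%N]expnS; move: base; move: (p ^ e)%N pe0 => P hP.
rewrite !expnMn => base.
rewrite [leqLHS]mulnA [leqRHS]mulnAC; apply: leq_mul => //.
by rewrite leq_pexp2l.
Qed.

(** Multiply the prime power bounds; [2304 = 32 * 9 * 4 * 2] collects the correcting factors. Cubing
    the totient matches the 8 per prime with the factor 2 per prime lost in the sieve. *)
Lemma totient_cube_bound (n : nat) : (0 < n)%N ->
  (8 ^ size (primes n) * n ^ 2 <= 2304 * totient n ^ 3)%N.
Proof.
move=> n0.
have -> : (8 ^ size (primes n) * n ^ 2 =
    \prod_(p <- primes n) (8 * (p ^ logn p n) ^ 2))%N.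
  rewrite big_split big_const_seq count_predT iter_muln_1; congr (_ * _)%N.
  under eq_bigr => p _ do rewrite expnS expn1.
  rewrite big_split /=.
  by rewrite {1}(prod_prime_decomp n0) prime_decompE big_map.
have cube : (totient n ^ 3 =
    \prod_(p <- primes n) (p.-1 * p ^ (logn p n).-1) ^ 3)%N.
  rewrite (totientE n0) !expnS expn0 muln1.
  under [RHS]eq_bigr => p _ do rewrite !expnS expn0 muln1.
  by rewrite !big_split.
apply: (@leq_trans (\prod_(p <- primes n) ((p.-1 * p ^ (logn p n).-1) ^ 3 *
    ((if p == 2 then 32 else 1) * (if p == 3 then 9 else 1) *
     (if p == 5 then 4 else 1) * (if p == 7 then 2 else 1))))).
  rewrite big_seq [leqRHS]big_seq; apply: leq_prod => p pn.
  apply: totient_prime_power_bound; last by rewrite logn_gt0.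
  by move: pn; rewrite mem_primes => /andP[].
rewrite big_split -cube /= mulnC leq_mul2r; apply/orP; right.
rewrite !big_split /= -[2304%N]/(32 * 9 * 4 * 2)%N.
by rewrite !leq_mul // prod_indicator_leq ?primes_uniq.
Qed.

(** Otherwise [t <= 2 ^ w * b.+2], and cubing cancels [8 ^ w], leaving [n ^ 2 <= 2304 * b.+2 ^ 3].
    Since [b ^ 4 <= 4 * n ^ 2], this forces [b <= 8 * 2304], far below [2 ^ 30]. *)
Lemma totient_gt_sieve_error (n b t w : nat) :
  (2 ^ 65 <= n)%N -> (b ^ 2 < 2 * n + 1)%N -> (2 * n + 1 <= b.+1 ^ 2)%N ->
  (8 ^ w * n ^ 2 <= 2304 * t ^ 3)%N -> (2 ^ w * b.+1 + 1 < t)%N.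
Proof.
move=> hn hb1 hb2 ht; rewrite ltnNge; apply/negP => htw.
have hb : (2 ^ 30 <= b)%N.
  rewrite leqNgt; apply/negP => hb.
  have : (b.+1 ^ 2 <= (2 ^ 30) ^ 2)%N by rewrite leq_exp2r.
  by lia.
have ht2 : (t <= 2 ^ w * b.+2)%N.
  by apply: leq_trans htw _; rewrite [leqRHS]mulnS addnC leq_add2r expn_gt0.
have ht3 : (t ^ 3 <= 8 ^ w * b.+2 ^ 3)%N.
  have -> : (8 ^ w = (2 ^ w) ^ 3)%N by rewrite -[8%N]/(2 ^ 3)%N -!expnM mulnC.
  by rewrite -expnMn leq_exp2r.
have {ht ht3} : (n ^ 2 <= 2304 * b.+2 ^ 3)%N.
  rewrite -(leq_pmul2l (_ : 0 < 8 ^ w)%N) ?expn_gt0 //.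
  apply: leq_trans ht _; rewrite mulnCA leq_mul2l; exact: ht3.
have h4 : (b ^ 4 <= 4 * n ^ 2)%N.
  rewrite -[4%N]/(2 * 2)%N expnM -[(2 * 2)%N]/(2 ^ 2)%N -expnMn leq_exp2r //; lia.
have h3 : (b.+2 ^ 3 <= 2 * b ^ 3)%N by rewrite !expnS expn0; nia.
move=> h2; have : (b ^ 4 <= 8 * 2304 * b ^ 3)%N.
  by move: h4 h3 h2; move: (b ^ 4)%N (b ^ 3)%N (n ^ 2)%N (b.+2 ^ 3)%N; lia.
rewrite expnS leq_mul2r expn_eq0; lia.
Qed.

Lemma exists_ceil_sqrt (m : nat) : exists b, (b ^ 2 < m.+1 <= b.+1 ^ 2)%N.
Proof.
elim: m => [|m [b /andP[h1 h2]]]; first by exists 0%N.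
have [h3|h3] := leqP m.+2 (b.+1 ^ 2); first by exists b; rewrite h3 andbT ltnW.
exists b.+1; rewrite h3 /=; apply: (leq_ltn_trans h2).
by rewrite ltn_exp2r.
Qed.

(** * Generators with a prescribed character value, and the orderings *)

(** If no generator gave [e], then [- e * quad_char (c + h)] would be 1 at every generator [h], save
    for the value 0 if [h = - c]. The sum would be at least [totient n - 1], beyond the sieve
    error. *)
Lemma exists_prim_root_quad_char (F : finFieldType) (n : nat) (c : F) (e : int) :
  #|F| = (2 * n + 1)%N -> (2 ^ 66 < #|F|)%N -> c != 0 -> e = 1 \/ e = -1 ->
  exists2 h : F, n.-primitive_root h & quad_char (c + h) = e.
Proof.
move=> hq hbig c0 he; have n0 := card_odd_half_gt0 hq.
pose P := [pred x : F | n.-primitive_root x].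
have [h /andP[ph /eqP qh]|none] :=
  pickP [pred h : F | n.-primitive_root h && (quad_char (c + h) == e)].
  by exists h.
exfalso.
have lower (h : F) : P h -> 1 - (h == - c)%:R <= - e * quad_char (c + h).
  move=> /= ph; have := none h; rewrite /= ph /= => /eqP ne.
  have [->|hc] := eqVneq h (- c); first by rewrite !subrr quad_char0 mulr0.
  have ch0 : c + h != 0 by rewrite addrC addr_eq0.
  move: ne; rewrite /quad_char (negPf ch0).
  by case: he => ->; case: ifP.
(* Here [b.+1] is the ceiling of the square root of [#|F|]. *)
have [b /andP[hb1 hb2]] := exists_ceil_sqrt (2 * n).
rewrite -[(2 * n).+1]addn1 in hb1 hb2.
have bnd (m : nat) : (0 < m)%N ->
    `|\sum_(x : F | x ^+ m == 1) quad_char (c + x)| <= b.+1%:R :> int.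
  move=> m0; rewrite -(@ler_pXn2r _ 2) ?nnegrE // -normrX ger0_norm ?sqr_ge0 //.
  apply: le_trans (quad_char_sum_roots hq m0 c0) _.
  by rewrite -natrX ler_nat hq.
have := sieve_bound bnd [seq (n %/ p)%N | p <- primes n] n0.
rewrite size_map (eq_bigl P); last first.
  by move=> x; rewrite /= (prim_root_maximal_divisors _ n0).
set G := \sum_(_ | _) _ => hG.
have : \sum_(h : F | P h) (1 - (h == - c)%:R) <= - e * G.
  by rewrite mulr_sumr; apply: ler_sum.
rewrite big_split /= sumrN sumr_const.
have one : \sum_(h : F | P h) (h == - c)%:R <= 1 :> int.
  rewrite -natr_sum lern1 -big_mkcondr sum1_card.
  by rewrite -(card1 (- c)); apply/subset_leq_card/subsetP => x /andP[].
have [z pz] := primitive_root_of_squares hq.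
have tot := totient_le_card_prim_roots pz.
have hn : (2 ^ 65 <= n)%N by lia.
have := totient_gt_sieve_error hn hb1 hb2 (totient_cube_bound n0).
rewrite -mulrnA in hG.
move: one hG tot he.
move: (\sum_(_ | _) _) (totient n) (#|_|) => u t k.
by rewrite mulnC; move: (_ * _)%N => w; lia.
Qed.

Lemma prim_root_powers_ordering (F : finFieldType) (n : nat) (h : F) :
  #|F| = (2 * n + 1)%N -> n.-primitive_root h ->
  ordering_of (nonzero_squares F) (fun i : 'I_n => h ^+ i).
Proof.
move=> hq ph; split=> [i j /eqP|].
  by rewrite (eq_prim_root_expr ph) !modn_small // => /eqP /val_inj.
apply/setP => x; rewrite (mem_nonzero_squares _ hq).
apply/imsetP/eqP => [[i _ ->]|xn].
  by rewrite -exprM mulnC exprM (prim_expr_order ph) expr1n.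
by have [i ->] := prim_rootP ph xn; exists i.
Qed.

Lemma prim_root_powers_cyclic (F : finFieldType) (n : nat) (h s : F) (e : int) :
  #|F| = (2 * n + 1)%N -> n.-primitive_root h -> e != 0 ->
  quad_char (1 + s * h) = e ->
  [set h ^+ i + s * h ^+ ordS i | i : 'I_n] = [set x : F | quad_char x == e].
Proof.
move=> hq ph e0 qe.
have u0 : 1 + s * h != 0.
  by apply: contraNneq e0 => u0; rewrite -qe u0 quad_char0.
have step (i : 'I_n) : h ^+ i + s * h ^+ ordS i = h ^+ i * (1 + s * h).
  (* [ordS] reduces the exponent modulo [n], which [h ^+ n = 1] absorbs, so the wrap-around term
     obeys the same formula. *)
  by rewrite /= (prim_expr_mod ph) exprSr mulrDr mulr1 mulrCA.
apply/setP => x; rewrite inE; apply/imsetP/eqP => [[i _ ->]|qx].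
  rewrite step (quad_charM _ _ hq) qe.
  have /eqP -> : quad_char (h ^+ i) == 1.
    rewrite quad_char_eq1 (mem_nonzero_squares _ hq) -exprM mulnC exprM.
    by rewrite (prim_expr_order ph) expr1n.
  by rewrite mul1r.
have xu : (x / (1 + s * h)) ^+ n = 1.
  apply/eqP; rewrite -(mem_nonzero_squares _ hq) -quad_char_eq1; apply/eqP.
  by apply: (mulIf e0); rewrite -{1}qe -(quad_charM _ _ hq) divfK // mul1r.
have [i hi] := prim_rootP ph xu.
by exists i; rewrite // step -hi divfK.
Qed.

Lemma exists_cyclic_ordering (F : finFieldType) (n : nat) (s : F) (R : {set F}) :
  #|F| = (2 * n + 1)%N -> (2 ^ 66 < #|F|)%N -> s ^+ 2 = 1 ->
  R = nonzero_squares F \/ R = nonsquares F ->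
  exists a : 'I_n -> F, ordering_of (nonzero_squares F) a /\
    [set a i + s * a (ordS i) | i : 'I_n] = R.
Proof.
move=> hq hbig s1 hR.
have s0 : s != 0 by rewrite -sqrf_eq0 s1 oner_eq0.
have [e he ->] : exists2 e : int, e = 1 \/ e = -1 &
    R = [set x : F | quad_char x == e].
  case: hR => ->; [exists 1 | exists (-1)]; [by left| |by right|];
    by apply/setP => x; rewrite inE ?quad_char_eq1 ?quad_char_eqN1.
have qs2 := quad_char_sqr s0.
(* The value asked of [s + h] carries the factor [quad_char s] because [1 + s * h = s * (s + h)]. *)
have [|h ph qh] := @exists_prim_root_quad_char F n s (quad_char s * e) hq hbig s0.
  by move: qs2 => /eqP; rewrite sqrf_eq1 => /orP[]/eqP ->; case: he => ->; auto.
exists (fun i : 'I_n => h ^+ i); split; first exact: prim_root_powers_ordering.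
apply: prim_root_powers_cyclic => //; first by case: he => ->.
have -> : 1 + s * h = s * (s + h) by rewrite mulrDr -expr2 s1.
by rewrite (quad_charM _ _ hq) qh mulrA -expr2 qs2 mul1r.
Qed.

Theorem theorem1p6 (F : finFieldType) (n : nat)
    (hq : #|F| = (2 * n + 1)%N) (hbig : (2 ^ 66 < #|F|)%N)
    (R : {set F}) (hR : R = nonzero_squares F \/ R = nonsquares F) :
  (exists a : 'I_n -> F,
     ordering_of (nonzero_squares F) a /\ cyclic_sums a = R) /\
  (exists b : 'I_n -> F,
     ordering_of (nonzero_squares F) b /\ cyclic_diffs b = R).
Proof.
split.
  have [a [oa <-]] := exists_cyclic_ordering hq hbig (expr1n F 2) hR.
  exists a; split=> //; apply: eq_imset => i; by rewrite mul1r.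
have [|b [ob <-]] := exists_cyclic_ordering (s := -1) hq hbig _ hR.
  by rewrite sqrrN expr1n.
by exists b; split=> //; apply: eq_imset => i; rewrite mulN1r.
Qed.
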